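(* Let $G$ be a finite connected even graph, let $\mathcal{C}$ be a cycle decomposition of $G$, and let $CI(G)$ be the cycle intersection graph of $G$ with respect to $\mathcal{C}$. If $CI(G)$ is a tree, then $\nabla(G)=|MSF(CI(G))|$.
   Context: An even graph is a graph in which every vertex has even degree (multiple edges are allowed). A cycle decomposition of $G$ is a collection of cycles of $G$ whose edge sets partition $E(G)$. The cycle intersection graph $CI(G)$ with respect to $\mathcal{C}$ is the (multi)graph with vertex set $\mathcal{C}$ having, for each pair of distinct cycles $C,C'\in\mathcal{C}$ and each vertex $v\in V(C)\cap V(C')$, one edge joining $C$ and $C'$. For a graph $H$, the size of a spanning forest $F$ of $H$ (a spanning acyclic subgraph) is $|E(F)|$ plus the number of vertices of degree $0$ in $F$; $|MSF(H)|$ denotes the minimum size of a spanning forest of $H$. A decycling set of $G$ is a set $S\subseteq V(G)$ with $G\setminus S$ acyclic; $\nabla(G)$ is the minimum size of a decycling set. *)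

(* Defs.v *)
From HB Require Import structures.
From mathcomp Require Import all_boot.
Set Implicit Arguments.
Unset Strict Implicit.
Unset Printing Implicit Defensive.

(* Finite loopless multigraphs: parallel edges are distinct elements of
   [edge] having the same two-element set of end points. *)
Record mgraph := MGraph {
  vertex : finType;
  edge : finType;
  ends : edge -> {set vertex};
  card_ends : forall e, #|ends e| = 2
}.

Section MultiGraph.
Variable G : mgraph.
Implicit Types (v : vertex G) (e : edge G) (A B F : {set edge G}).
Implicit Types (S : {set vertex G}).

(* Degree of [v] in the spanning subgraph with edge set [F]. *)
Definition deg_in F v := #|[set e in F | v \in ends e]|.

Definition even_graph := [forall v, ~~ odd (deg_in [set: edge G] v)].

Definition adj : rel (vertex G) := fun u v => [exists e, ends e == [set u; v]].

(* The graph without vertices is not connected. *)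
Definition connected_graph :=
  (0 < #|vertex G|) && [forall u, forall v, connect adj u v].

(* A cycle of length n >= 2 consists of distinct vertices v_0, ..., v_(n-1) and
   distinct edges e_0, ..., e_(n-1), where e_i joins v_i and v_(i+1 mod n); two
   parallel edges form a cycle.  A cycle is represented by its edge set, so that
   its length is the cardinal of that set. *)
Definition is_cycle B :=
  (1 < #|B|) &&
  [exists v : {ffun 'I_#|B| -> vertex G}, exists e : {ffun 'I_#|B| -> edge G},
    [&& injectiveb v, injectiveb e,
        [forall i, ends (e i) == [set v i; v (ordS i)]]
      & B == [set e i | i : 'I_#|B|]]].

Lemma is_cycleP B :
  reflect (exists n (v : 'I_n -> vertex G) (e : 'I_n -> edge G),
             [/\ 1 < n, injective v, injective e,
                 forall i, ends (e i) = [set v i; v (ordS i)]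
               & B = [set e i | i : 'I_n]])
          (is_cycle B).
Proof.
apply: (iffP andP) => [[B1 /existsP[v /existsP[e]]] | [n [v [e [n1 vI eI eE defB]]]]].
  case/and4P=> /injectiveP vI /injectiveP eI /forallP eE /eqP defB.
  by exists #|B|, v, e; split=> // i; apply/eqP.
have Bn : #|B| = n by rewrite defB card_imset // card_ord.
case: n / Bn v e n1 vI eI eE defB => v e n1 vI eI eE defB; split=> //.
apply/existsP; exists (finfun v); apply/existsP; exists (finfun e); apply/and4P; split.
- by apply/injectiveP=> i j; rewrite !ffunE => /vI.
- by apply/injectiveP=> i j; rewrite !ffunE => /eI.
- by apply/forallP=> i; rewrite !ffunE eE.
by apply/eqP; rewrite [LHS]defB; apply: eq_imset => i; rewrite ffunE.
Qed.

Definition cycle_vertices B : {set vertex G} := \bigcup_(e in B) ends e.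

(* The subgraph with edge set [A] (whatever its vertex set) has no cycle. *)
Definition acyclic A := [forall B : {set edge G}, (B \subset A) ==> ~~ is_cycle B].

Definition is_tree := connected_graph && acyclic [set: edge G].

Definition edges_avoiding S : {set edge G} := [set e | [disjoint ends e & S]].

Definition decycling S := acyclic (edges_avoiding S).

Definition forest_size F := #|F| + #|[set v | deg_in F v == 0]|.

Lemma acyclic0 : acyclic set0.
Proof.
by apply/forallP=> B; apply/implyP; rewrite subset0 => /eqP->; rewrite /is_cycle cards0.
Qed.

Lemma decyclingT : decycling setT.
Proof.
suff -> : decycling setT = acyclic set0 by exact: acyclic0.
congr acyclic; apply/setP=> e; rewrite !inE; apply/negbTE.
have /card_gt0P[v ve] : 0 < #|ends e| by rewrite card_ends.
by apply/negP=> /pred0P/(_ v); rewrite /= ve inE.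
Qed.

(* Both minima range over nonempty families, by [decyclingT] and [acyclic0];
   a spanning forest is given by its edge set. *)
Definition decycling_number : nat :=
  #|[arg min_(S < setT | decycling S) #|S|]|.

Definition msf_size : nat :=
  forest_size [arg min_(F < set0 | acyclic F) forest_size F].

Definition cycle_decomposition (D : {set {set edge G}}) :=
  partition D [set: edge G] && [forall C in D, is_cycle C].

End MultiGraph.

Section CycleIntersectionGraph.
Variables (G : mgraph) (D : {set {set edge G}}).

Definition CI_vertex : finType := {C : {set edge G} | C \in D}.

(* One edge ({C, C'}, v) for every unordered pair of distinct members of [D] and
   every common vertex v of C and C'. *)
Definition CI_edge : finType :=
  {p : {set CI_vertex} * vertex G |
    (#|p.1| == 2) && [forall C in p.1, p.2 \in cycle_vertices (val C)]}.

Definition CI_ends (x : CI_edge) : {set CI_vertex} := (val x).1.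

Lemma card_CI_ends x : #|CI_ends x| = 2.
Proof. by case/andP: (valP x) => /eqP. Qed.

Definition CI : mgraph := MGraph card_CI_ends.

End CycleIntersectionGraph.

(* Main.v *)
(* When CI(G) is a tree, every cycle of G contains, hence is, a member of the
   decomposition D; so a set of vertices is decycling if and only if it meets
   every member of D.  As CI(G) has no triangle, a vertex of G lies on at most
   two members of D, so the vertices lying on two of them are the edges of CI(G).
   A minimum hitting set thus corresponds to a set F of edges of CI(G) together
   with one private vertex for each member of D that F leaves isolated, and F is
   a forest since CI(G) is one. *)
Require Import Defs.
From mathcomp Require Import all_boot.
From mathcomp Require Import zify.

Set Implicit Arguments.
Unset Strict Implicit.
Unset Printing Implicit Defensive.

(** Iterating [ordS] from any index runs through all of ['I_n]. *)
Lemma ordS_closed n (P : pred 'I_n) i j :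
  (forall k, P k -> P (ordS k)) -> P i -> P j.
Proof.
move=> PS Pi.
have iterP m : exists2 k : 'I_n, P k & k = (i + m) %% n :> nat.
  elim: m => [|m [k Pk kE]]; first by exists i; rewrite // addn0 modn_small.
  exists (ordS k); first exact: PS.
  by rewrite /= kE -addn1 modnDml addn1 addnS.
(* This many steps lead from [i] to [j + n], that is [j] modulo [n], with no case distinction on the
   order of [i] and [j]. *)
have [k Pk kE] := iterP (j + (n - i)).
suff -> : j = k by [].
apply: val_inj; rewrite /= kE addnCA subnKC ?modnDr ?modn_small //.
exact: ltnW.
Qed.

(** * Cycles, leaves and decycling sets in multigraphs *)

Section MultiGraph.
Variable G : mgraph.
Implicit Types (F B C : {set edge G}) (S : {set vertex G}).

Lemma acyclic_sub F F' : F \subset F' -> acyclic F' -> acyclic F.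
Proof.
move=> sFF' /forallP acF'; apply/forallP=> B; apply/implyP=> sBF.
by apply: (implyP (acF' B)); apply: subset_trans sFF'.
Qed.

Lemma cycle_verticesP F u :
  reflect (exists2 e, e \in F & u \in ends e) (u \in cycle_vertices F).
Proof. exact: bigcupP. Qed.

Lemma cycle_vertices_sub F F' :
  F \subset F' -> cycle_vertices F \subset cycle_vertices F'.
Proof.
move=> /subsetP sFF'; apply/subsetP=> u /cycle_verticesP[e eF ue].
by apply/cycle_verticesP; exists e; rewrite ?sFF'.
Qed.

Lemma cycle_vertices_neq0 F : F != set0 -> cycle_vertices F != set0.
Proof.
case/set0Pn=> e eF; have /card_gt0P[u ue] : 0 < #|ends e| by rewrite card_ends.
by apply/set0Pn; exists u; apply/cycle_verticesP; exists e.
Qed.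

Lemma cycle_neq0 B : is_cycle B -> B != set0.
Proof. by case/andP=> /ltnW; rewrite card_gt0. Qed.

Lemma decyclingP S :
  reflect (forall B, is_cycle B -> ~~ [disjoint cycle_vertices B & S])
          (decycling S).
Proof.
have avoidE B : (B \subset edges_avoiding S) = [disjoint cycle_vertices B & S].
  apply/idP/idP=> [/subsetP sB | dBS].
    rewrite disjoint_subset; apply/subsetP=> u /cycle_verticesP[e /sB].
    by rewrite !inE => /pred0P/(_ u)/= + ue; rewrite ue /= => ->.
  apply/subsetP=> e eB; rewrite inE; apply: disjointWl dBS.
  by apply/subsetP=> u ue; apply/cycle_verticesP; exists e.
apply: (iffP forallP) => acS B; rewrite -?avoidE.
  by move=> cB; have := acS B; rewrite cB implybF.
by apply/implyP; apply: contraL => cB; rewrite avoidE acS.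
Qed.

(** By pigeonhole the walk revisits a vertex. At the first revisit, [x i = x j] with [j] least, the
    stretch from [i] to [j] closes up without any other repetition. *)
Lemma closed_walk_cycle (x : nat -> vertex G) (e : nat -> edge G) :
  (forall k, ends (e k) = [set x k; x k.+1]) -> (forall k, e k != e k.+1) ->
  exists2 B, is_cycle B & forall f, f \in B -> exists k, f = e k.
Proof.
move=> endsE eS.
have xS k : x k != x k.+1.
  by have := card_ends (e k); rewrite endsE cards2; case: eqP.
have rep : exists j, [exists i : 'I_j, x i == x j].
  have /injectivePn[i [j neq_ij xij]] :
      ~~ injectiveb (fun i : 'I_#|vertex G|.+1 => x i).
    by apply/negP=> /injectiveP/leq_card; rewrite card_ord ltnn.
  case: (ltngtP i j) => [ij|ji|/val_inj/eqP]; last by rewrite (negPf neq_ij).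
    by exists j; apply/existsP; exists (Ordinal ij); rewrite /= xij.
  by exists i; apply/existsP; exists (Ordinal ji); rewrite /= xij.
case: (ex_minnP rep) => j /existsP[[i /= ij] /eqP xij] minj.
have xI k l : k < j -> l < j -> x k = x l -> k = l.
  have aux p q : p < q -> q < j -> x p = x q -> False.
    move=> pq qj xpq; suff /minj : [exists p : 'I_q, x p == x q] by lia.
    by apply/existsP; exists (Ordinal pq); rewrite /= xpq.
  by case: (ltngtP k l) => // kl kj lj xkl;
    [case: (aux k l) | case: (aux l k)].
(* There are no loops, so the closed stretch has at least two edges. *)
have ij1 : i.+1 != j by apply: contraNneq (xS i) => ->; rewrite xij.
pose v (k : 'I_(j - i)) := x (i + k); pose f (k : 'I_(j - i)) := e (i + k).
have vS k : v (ordS k) = x (i + k).+1.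
  rewrite /v /=; have := ltn_ord k; rewrite leq_eqVlt => /orP[/eqP kn | kn].
    rewrite kn modnn addn0 xij; congr x; lia.
  by rewrite modn_small // addnS.
have vI : injective v.
  move=> k l /xI kl; apply: val_inj; have := ltn_ord k; have := ltn_ord l => /=.
  lia.
(* As the vertices before [j] are distinct, an edge used twice would be used at two consecutive
   steps, which [eS] forbids. *)
have fI : injective f.
  have aux (k l : 'I_(j - i)) : k < l -> f k = f l -> False.
    move=> kl fkl; have lj := ltn_ord l.
    have: ends (f k) = ends (f l) by rewrite fkl.
    rewrite /f !endsE => eqE.
    have: x (i + k) \in [set x (i + l); x (i + l).+1] by rewrite -eqE set21.
    have: x (i + l) \in [set x (i + k); x (i + k).+1] by rewrite eqE set21.
    rewrite !inE => /orP[/eqP/xI|/eqP/xI xlk _]; first lia.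
    have lk : i + l = (i + k).+1 by apply: xlk; lia.
    by have := eS (i + k); rewrite -lk -/(f k) fkl eqxx.
  move=> k l fkl; case: (ltngtP k l) => [/aux/(_ fkl)|/aux/(_ (esym fkl))|/val_inj] //.
exists [set f k | k : 'I_(j - i)]; last by move=> _ /imsetP[k _ ->]; exists (i + k).
apply/is_cycleP; exists (j - i), v, f; split=> //; first lia.
by move=> k; rewrite vS /f endsE.
Qed.

(** Without a vertex of degree 1, a walk in [F] can always leave by an edge other than the one it
    came by, so it goes on forever and yields a cycle. *)
Lemma acyclic_leaf F : acyclic F -> F != set0 -> exists x, deg_in F x = 1.
Proof.
move=> /forallP acF /set0Pn[e0 e0F].
suff /existsP[x /eqP] : [exists x, deg_in F x == 1] by exists x.
apply: contraT => /existsPn noleaf.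
have /card_gt0P[x0 x0e0] : 0 < #|ends e0| by rewrite card_ends.
(* A state is a vertex together with the edge of [F] by which the walk will leave it. *)
pose ok (d : vertex G * edge G) := (d.2 \in F) && (d.1 \in ends d.2).
pose step (d d' : vertex G * edge G) :=
  [&& ok d', ends d.2 == [set d.1; d'.1] & d.2 != d'.2].
have stepP d : ok d -> exists d', step d d'.
  case: d => x e /andP[/= eF xe].
  have /eqP/cards2P[a [b [_ eE]]] := card_ends e.
  have [y eY] : exists y, ends e = [set x; y].
    by move: xe; rewrite eE !inE => /orP[]/eqP->; [exists b | exists a; rewrite setUC].
  have ye : y \in ends e by rewrite eY set22.
  have /subsetPn[f] : ~~ ([set g in F | y \in ends g] \subset [set e]).
    apply: contra (noleaf y) => sub; rewrite /deg_in.
    suff -> : [set g in F | y \in ends g] = [set e] by rewrite cards1.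
    by apply/eqP; rewrite eqEsubset sub sub1set inE eF.
  rewrite !inE => /andP[fF yf] fe; exists (y, f).
  by rewrite /step /ok /= fF yf eY eqxx eq_sym.
(* The default [d] never occurs along the walk, since every state reached satisfies [ok]. *)
pose next d := odflt d [pick d' | step d d'].
have nextP d : ok d -> step d (next d).
  move=> /stepP[d' dd']; rewrite /next; case: pickP => // /(_ d').
  by rewrite dd'.
pose w k := iter k next (x0, e0).
have wok k : ok (w k).
  elim: k => [|k /nextP/and3P[]//]; exact/andP.
have wS k : step (w k) (w k.+1) by apply: nextP.
have [B cB sB] : exists2 B, is_cycle B & forall f, f \in B -> exists k, f = (w k).2.
  apply: closed_walk_cycle (fun k => (w k).1) (fun k => (w k).2) _ _ => k;
  by have /and3P[_ /eqP] := wS k.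
have := acF B; rewrite cB implybF => /negP; case.
by apply/subsetP=> f /sB[k ->]; case/andP: (wok k).
Qed.

Lemma cycle_deg B u : is_cycle B -> u \in cycle_vertices B -> deg_in B u = 2.
Proof.
move=> /is_cycleP[n [v [e [n1 vI eI eE ->]]]] /cycle_verticesP[_ /imsetP[k _ ->] uk].
(* Writing the vertex with [ordS] makes its two edges [e i] and [e (ordS i)]. *)
have [i ->] : exists i, u = v (ordS i).
  move: uk; rewrite eE !inE => /orP[]/eqP->; last by exists k.
  by exists (ord_pred k); rewrite ord_predK.
have iS : i != ordS i.
  rewrite -val_eqE /=; have := ltn_ord i; rewrite leq_eqVlt => /orP[/eqP in_|in_].
    by rewrite in_ modnn; lia.
  rewrite modn_small //; lia.
rewrite /deg_in.
suff -> : [set f in [set e i | i : 'I_n] | v (ordS i) \in ends f] = [set e i; e (ordS i)].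
  by rewrite cards2 (inj_eq eI) iS.
apply/setP=> f; rewrite !inE; apply/andP/orP=> [[/imsetP[j _ ->]]|].
  rewrite eE !inE !(inj_eq vI) => /orP[/eqP->|/eqP/(can_inj (@ordSK _))->];
  by [right | left].
by case=> /eqP->; rewrite imset_f // eE !inE eqxx ?orbT.
Qed.

(** Once around [C], the edges pass at some vertex from inside [B] to outside and at some vertex
    back again. Each such vertex has one of its two edges of [C] in [B]. *)
Lemma cycle_boundary B C :
    is_cycle C -> C :&: B != set0 -> ~~ (C \subset B) ->
  exists u u', [/\ u != u', deg_in (C :&: B) u = 1 & deg_in (C :&: B) u' = 1].
Proof.
move=> /is_cycleP[n [v [e [n1 vI eI eE ->]]]].
move=> /set0Pn[_ /setIP[/imsetP[i _ ->] iB]] /subsetPn[_ /imsetP[j _ ->] jB].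
have edges_at (k : 'I_n) g : g \in [set e i | i : 'I_n] -> v (ordS k) \in ends g ->
    g = e k \/ g = e (ordS k).
  move=> /imsetP[l _ ->]; rewrite eE !inE !(inj_eq vI).
  by case/orP=> [/eqP->|/eqP/(can_inj (@ordSK _))->]; [right | left].
have deg1 (k : 'I_n) : (e k \in B) != (e (ordS k) \in B) ->
    deg_in ([set e i | i : 'I_n] :&: B) (v (ordS k)) = 1.
  move=> kB; apply/eqP/cards1P; exists (if e k \in B then e k else e (ordS k)).
  apply/setP=> g; rewrite !inE -andbA; apply/and3P/eqP=> [[gC gB gv]|->].
    have [gE|gE] := edges_at _ _ gC gv; rewrite gE in gB *; first by rewrite gB.
    by move: kB; rewrite gB; case: (e k \in B).
  case: ifP kB => kB; rewrite imset_f // eE !inE eqxx ?orbT //.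
  by case: (e (ordS k) \in B).
have [k kB kB'] : exists2 k, e k \in B & e (ordS k) \notin B.
  have [/existsP[k /andP[]]|/existsPn none] :=
    boolP [exists k, (e k \in B) && (e (ordS k) \notin B)]; first by exists k.
  case/negP: jB; apply: (@ordS_closed n [pred k | e k \in B] i) => // k /= kB.
  by have := none k; rewrite kB negbK.
have [l lB lB'] : exists2 l, e l \notin B & e (ordS l) \in B.
  have [/existsP[l /andP[]]|/existsPn none] :=
    boolP [exists l, (e l \notin B) && (e (ordS l) \in B)]; first by exists l.
  suff : e i \notin B by rewrite iB.
  apply: (@ordS_closed n [pred k | e k \notin B] j) => // l /= lB.
  by have := none l; rewrite lB.
exists (v (ordS k)), (v (ordS l)); split.
- rewrite (inj_eq vI) (can_eq (@ordSK _)).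
  by apply: contraNneq lB => <-.
- by apply: deg1; rewrite kB (negPf kB').
- by apply: deg1; rewrite lB' (negPf lB).
Qed.

End MultiGraph.

(** * Structure imposed by an acyclic cycle intersection graph *)

Section CycleIntersection.
Variables (G : mgraph) (D : {set {set edge G}}).
Hypotheses (hD : cycle_decomposition D) (hac : acyclic [set: edge (CI D)]).
Implicit Types (C : CI_vertex D) (v : vertex G) (F : {set edge (CI D)}).

Lemma decomposition_cycle C : is_cycle (val C).
Proof. by case/andP: hD => _ /forall_inP/(_ _ (valP C)). Qed.

Lemma decomposition_cover e : exists C, e \in val C.
Proof.
case/andP: hD => /and3P[/eqP covD _ _] _.
have : e \in cover D by rewrite covD inE.
by case/bigcupP=> C CD eC; exists (Sub C CD).
Qed.

Lemma CI_edge_exists C C' v :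
    C != C' -> v \in cycle_vertices (val C) -> v \in cycle_vertices (val C') ->
  exists x : edge (CI D), val x = ([set C; C'], v).
Proof.
move=> neq vC vC'.
have H : (#|([set C; C'], v).1| == 2)
    && [forall K in ([set C; C'], v).1, ([set C; C'], v).2 \in cycle_vertices (val K)].
  rewrite /= cards2 neq /=; apply/forall_inP=> K.
  by rewrite !inE => /orP[]/eqP->.
by exists (Sub ([set C; C'], v) H).
Qed.

Lemma CI_edge_vertex (x : edge (CI D)) C :
  C \in (val x).1 -> (val x).2 \in cycle_vertices (val C).
Proof. by case/andP: (valP x) => _ /forall_inP; apply. Qed.

Lemma two_edges_not_leaf F C (x y : edge (CI D)) :
    x != y -> x \in F -> y \in F -> C \in (val x).1 -> C \in (val y).1 ->
  deg_in F (C : vertex (CI D)) <> 1.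
Proof.
move=> neq xF yF Cx Cy /eqP/cards1P[z zE].
have: x \in [set z] by rewrite -zE inE xF.
have: y \in [set z] by rewrite -zE inE yF.
by rewrite !inE => /eqP yz /eqP xz; rewrite xz yz eqxx in neq.
Qed.

(* Three cycles through [v] would span a triangle of [CI D]. *)
Lemma card_cycles_through v :
  #|[set C : CI_vertex D | v \in cycle_vertices (val C)]| <= 2.
Proof.
rewrite leqNgt; apply/negP; set X := [set C | _] => X3.
(* These edges form a complete graph on [X]. With at least three members it has no vertex of degree
   1, so [acyclic_leaf] applies and no triangle need be exhibited. *)
pose F : {set edge (CI D)} := [set x | (val x).2 == v].
have two C : C \in X -> exists x y : edge (CI D),
    [/\ x != y, x \in F, y \in F, C \in (val x).1 & C \in (val y).1].
  move=> CX; move: (CX); rewrite inE => vC.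
  have /card_gt1P[C1 [C2 []]] : 1 < #|X :\ C| by move: X3; rewrite (cardsD1 C) CX.
  rewrite !inE => /andP[n1 vC1] /andP[n2 vC2] n12.
  rewrite eq_sym in n1; rewrite eq_sym in n2.
  have [x xE] := CI_edge_exists n1 vC vC1; have [y yE] := CI_edge_exists n2 vC vC2.
  exists x, y; rewrite !inE xE yE /= eqxx !set21; split=> //.
  apply: contraNneq n12 => xy; have : C1 \in (val y).1 by rewrite -xy xE set22.
  by rewrite yE !inE eq_sym (negPf n1).
have /card_gt0P[C0 C0X] : 0 < #|X| by apply: leq_trans X3.
have [x0 [_ [_ x0F _ _ _]]] := two C0 C0X.
have [|C C1] := acyclic_leaf (acyclic_sub (subsetT F) hac).
  by apply/set0Pn; exists x0.
have /cards1P[z zE] := introT eqP C1.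
have: z \in [set z] by rewrite inE.
rewrite -zE !inE => /andP[/eqP zv Cz].
have CX : C \in X by rewrite inE -zv; exact: CI_edge_vertex.
have [x [y [xy xF yF Cx Cy]]] := two C CX.
exact: two_edges_not_leaf xy xF yF Cx Cy C1.
Qed.

(* Otherwise [B] leaves every member of [D] that it meets at two distinct
   vertices, through each of which it continues into another member of [D]: the
   members of [D] meeting [B] induce a subgraph of [CI D] without leaves. *)
Lemma cycle_contains_member B : is_cycle B -> exists C, val C \subset B.
Proof.
move=> cB; apply/existsP; apply: contraT => /existsPn noC.
pose X : {set CI_vertex D} := [set C | val C :&: B != set0].
pose F := [set x : edge (CI D) | (val x).1 \subset X].
(* The cycle [B] has two edges at [u], only one of them in [C]. The other lies in some member [C'],
   and the common vertex [u] gives an edge of [CI D] from [C] to [C']. *)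
have leave C u : C \in X -> deg_in (val C :&: B) u = 1 ->
    exists2 x : edge (CI D), x \in F & (C \in (val x).1) && ((val x).2 == u).
  move=> CX d1; have /cards1P[e eE] := introT eqP d1.
  have : e \in [set e] by rewrite inE.
  rewrite -eE !inE => /andP[/andP[eC eB] ue].
  have d2 : deg_in B u = 2 by apply: cycle_deg => //; apply/cycle_verticesP; exists e.
  have /subsetPn[f] : ~~ ([set g in B | u \in ends g] \subset val C).
    apply/negP=> /subsetP sub; suff : deg_in B u = 1 by rewrite d2.
    rewrite -d1 /deg_in; congr #|pred_of_set _|; apply/setP=> g; rewrite !inE.
    case: (boolP (g \in B)) => gB; rewrite ?andbF //= andbT.
    case: (boolP (u \in ends g)) => ug; rewrite ?andbF //= andbT.
    by rewrite sub // inE gB.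
  rewrite inE => /andP[fB uf] fC; have [C' fC'] := decomposition_cover f.
  have neq : C != C' by apply: contraNneq fC => ->.
  have [||x xE] := @CI_edge_exists C C' u neq.
  - by apply/cycle_verticesP; exists e.
  - by apply/cycle_verticesP; exists f.
  exists x; rewrite ?inE xE /= ?set21 ?eqxx // subUset !sub1set CX inE.
  by apply/set0Pn; exists f; rewrite inE fC'.
have two C : C \in X -> exists x y : edge (CI D),
    [/\ x != y, x \in F, y \in F, C \in (val x).1 & C \in (val y).1].
  move=> CX; move: (CX); rewrite inE => CB.
  have [u [u' [neq du du']]] := cycle_boundary (decomposition_cycle C) CB (noC C).
  have [x xF /andP[Cx /eqP xu]] := leave _ _ CX du.
  have [y yF /andP[Cy /eqP yu]] := leave _ _ CX du'.
  (* Both edges may lead to the same member of [D]; they are then parallel, and still distinct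
     because their vertices [u] and [u'] are. *)
  by exists x, y; split=> //; apply: contraNneq neq => xy; rewrite -xu -yu xy.
have /set0Pn[e eB] := cycle_neq0 cB; have [C0 eC0] := decomposition_cover e.
have C0X : C0 \in X by rewrite inE; apply/set0Pn; exists e; rewrite inE eC0.
have [x0 [_ [_ x0F _ _ _]]] := two C0 C0X.
have [|C C1] := acyclic_leaf (acyclic_sub (subsetT F) hac).
  by apply/set0Pn; exists x0.
have /cards1P[z zE] := introT eqP C1.
have: z \in [set z] by rewrite inE.
rewrite -zE !inE => /andP[/subsetP zX Cz].
have [x [y [xy xF yF Cx Cy]]] := two C (zX C Cz).
by case: (two_edges_not_leaf xy xF yF Cx Cy C1).
Qed.

(** * From decycling sets to spanning forests and back *)

Lemma decycling_hitting (S : {set vertex G}) :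
  reflect (forall C, exists2 v, v \in cycle_vertices (val C) & v \in S) (decycling S).
Proof.
apply: (iffP (decyclingP S)) => hit.
  by move=> C; have /pred0Pn[v /andP[]] := hit _ (decomposition_cycle C); exists v.
move=> B /cycle_contains_member[C /cycle_vertices_sub/subsetP sub].
by have [v vC vS] := hit C; apply/pred0Pn; exists v; rewrite /= sub.
Qed.

(** A member of [D] covered by [F] is hit at the vertex labelling one of its edges; each isolated
    member gets a vertex of its own. Coinciding choices only make [S] smaller. *)
Lemma decycling_of_forest F :
  exists2 S : {set vertex G}, decycling S & #|S| <= forest_size F.
Proof.
have pickv C : exists v, v \in cycle_vertices (val C).
  by apply/set0Pn/cycle_vertices_neq0/cycle_neq0/decomposition_cycle.
pose h C := xchoose (pickv C); pose I := [set C : vertex (CI D) | deg_in F C == 0].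
pose S := [set (val (x : edge (CI D))).2 | x in F] :|: [set h C | C in I].
exists S; last first.
  apply: leq_trans (leq_card_setU _ _) _; rewrite leq_add ?leq_imset_card //.
apply/decycling_hitting=> C; have [Ciso|Ciso] := boolP (C \in I).
  by exists (h C); [exact: xchooseP (pickv C) | rewrite inE orbC imset_f].
have /card_gt0P[x] : 0 < deg_in F (C : vertex (CI D)) by rewrite inE in Ciso; rewrite lt0n.
rewrite inE => /andP[xF Cx]; exists (val x).2; first exact: CI_edge_vertex.
by apply/setUP; left; apply/imsetP; exists x.
Qed.

(** Take all edges of [CI D] labelled by a vertex of [S]. Their labels, and one vertex of [S] on
    each isolated member, are pairwise distinct elements of [S]. *)
Lemma forest_of_decycling (S : {set vertex G}) :
  decycling S -> exists2 F : {set edge (CI D)}, acyclic F & forest_size F <= #|S|.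
Proof.
move=> /decycling_hitting hit.
have {}hit C : exists v, (v \in cycle_vertices (val C)) && (v \in S).
  by have [v vC vS] := hit C; exists v; rewrite vC.
pose h C := xchoose (hit C).
have hP C : (h C \in cycle_vertices (val C)) && (h C \in S) by exact: xchooseP (hit C).
pose F : {set edge (CI D)} := [set x | (val x).2 \in S].
pose I := [set C : vertex (CI D) | deg_in F C == 0].
exists F; first exact: acyclic_sub (subsetT F) hac.
(* A second member through [h C] would create an edge of [F] at the isolated member [C]. *)
have alone C C' : C \in I -> h C \in cycle_vertices (val C') -> C = C'.
  rewrite inE cards_eq0 => /eqP noedge hC'; apply/eqP; apply: contraT => neq.
  have /andP[hC hS] := hP C; have [x xE] := CI_edge_exists neq hC hC'.
  have : x \in [set e in F | (C : vertex (CI D)) \in ends e].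
    by rewrite !inE xE hS /= /CI_ends xE set21.
  by rewrite noedge inE.
have hI : {in I &, injective h}.
  by move=> C C' Ciso _ hCC'; apply: alone => //; rewrite hCC'; case/andP: (hP C').
pose p (x : edge (CI D)) := (val x).2.
have pI : injective p.
  (* The two ends of [x] pass through its label, and at most two members do; hence the label
     determines the edge. *)
  have through x : (val x).1 = [set C : CI_vertex D | p x \in cycle_vertices (val C)].
    apply/eqP; rewrite eqEcard; apply/andP; split.
      by apply/subsetP=> C /CI_edge_vertex; rewrite inE.
    by have /andP[/eqP-> _] := valP x; exact: card_cycles_through.
  move=> x y pxy; apply: val_inj.
  rewrite [val x]surjective_pairing [val y]surjective_pairing.
  by rewrite !through -/(p x) -/(p y) pxy.
(* The label of an edge lies on two distinct members, whereas [h C] lies on [C] only when [C] is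
   isolated. *)
have disj : [disjoint p @: F & h @: I].
  apply/pred0P=> v; apply/negP=> /andP[/imsetP[x xF ->] /imsetP[C Ciso hC]].
  have all C' : C' \in (val x).1 -> C' = C.
    by move=> /CI_edge_vertex C'x; apply/esym/alone; rewrite -?hC.
  have /andP[/cards2P[a [b [/eqP neq xE]]] _] := valP x.
  have aC : a = C by apply: all; rewrite xE set21.
  have bC : b = C by apply: all; rewrite xE set22.
  by case: neq; rewrite aC bC.
rewrite /forest_size -/I -(card_imset _ pI) -(card_in_imset hI).
have /eqP <- : #|p @: F :|: h @: I| == #|p @: F| + #|h @: I|.
  by rewrite (leq_card_setU _ _).2.
apply: subset_leq_card; rewrite subUset; apply/andP; split.
  by apply/subsetP=> _ /imsetP[x + ->]; rewrite inE.
by apply/subsetP=> _ /imsetP[C _ ->]; case/andP: (hP C).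
Qed.

End CycleIntersection.

Theorem theorem2 (G : mgraph) (D : {set {set edge G}})
  (hconn : connected_graph G) (heven : even_graph G)
  (hD : cycle_decomposition D) (htree : is_tree (CI D)) :
  decycling_number G = msf_size (CI D).
Proof.
case/andP: htree => _ hac; rewrite /decycling_number /msf_size.
case: arg_minnP => [|S dS minS]; first exact: decyclingT.
case: arg_minnP => [|F acF minF]; first exact: acyclic0.
apply/eqP; rewrite eqn_leq; apply/andP; split.
  (* Each minimum is bounded by converting an optimum of the other problem. *)
  have [S' dS' leS'] := decycling_of_forest hD hac F.
  exact: leq_trans (minS _ dS') leS'.
have [F' acF' leF'] := forest_of_decycling hD hac dS.
exact: leq_trans (minF _ acF') leF'.
Qed.
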